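(* Let $n\ge 2$ and let $\mathcal C\subseteq\mathbb R^n$ be a convex body (compact, convex, with nonempty interior) that is symmetric with respect to the origin. Let $\lambda_1\le\dots\le\lambda_n$ be the successive minima of $\mathcal C$ with respect to $\mathbb Z^n$, and let $h(\mathcal C)$ be the maximum number of points that can be chosen from $\mathcal C\cap\mathbb Z^n$ such that no $n$ of them are linearly dependent. If $\lambda_n\le 1$, then $$h(\mathcal C)\ge \frac{1-\lambda_n}{16n^2}\min_{0<m<n}(\lambda_m\lambda_{m+1}\cdots\lambda_n)^{-\frac{1}{n-m}}.$$
   Context: For $1\le i\le n$, the $i$-th successive minimum of $\mathcal C$ is $\lambda_i=\min\{\lambda>0 : \dim\operatorname{span}(\lambda\mathcal C\cap\mathbb Z^n)\ge i\}$. *)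

(* Defs.v *)
From HB Require Import structures.
From mathcomp Require Import all_boot all_order all_algebra.
From mathcomp Require Import all_classical all_reals all_analysis.

Set Implicit Arguments.
Unset Strict Implicit.
Unset Printing Implicit Defensive.

Import Order.TTheory GRing.Theory Num.Theory.
Import numFieldNormedType.Exports.

Local Open Scope classical_set_scope.
Local Open Scope ring_scope.

(* [x0] is returned when the minimum (resp. maximum) is not attained. *)
Definition set_min d (T : porderType d) (x0 : T) (A : set T) : T :=
  xget x0 (A `&` lbound A).

Definition set_max d (T : porderType d) (x0 : T) (A : set T) : T :=
  xget x0 (A `&` ubound A).

(* [span] of mathcomp takes a finite sequence; this is the linear span of an
   arbitrary set of vectors, i.e. the least subspace containing it. It always
   exists because the ambient space has finite dimension, so the default value
   0 is never used. *)
Definition span_set (K : fieldType) (V : vectType K) (A : set V) : {vspace V} :=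
  xget 0%VS [set U : {vspace V} | (forall v, A v -> v \in U) /\
    forall W : {vspace V}, (forall v, A v -> v \in W) -> (U <= W)%VS].

Section Defs.
Context {R : realType} {n : nat}.
Implicit Types C : set 'rV[R]_n.

Definition convex_body C : Prop :=
  [/\ compact C, @convex_set R 'rV[R]_n C
    & interior C !=set0].

Definition origin_symmetric C : Prop := forall x, C x -> C (- x).

Definition int_lattice : set 'rV[R]_n := [set x | x \is a mxOver Num.int].

Definition successive_minimum C (i : nat) : R :=
  set_min 0 [set l : R | 0 < l /\
    (i <= \dim (span_set ([set l *: x | x in C] `&` int_lattice)))%N].

(* Vacuous when [s] has fewer than [n] points. *)
Definition no_n_dependent (s : seq 'rV[R]_n) : Prop :=
  forall t : n.-tuple 'rV[R]_n, uniq t -> {subset t <= s} -> free t.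

Definition max_general_position C : nat :=
  set_max 0%N [set k : nat | exists s : seq 'rV[R]_n,
    [/\ uniq s, size s = k, (forall x, x \in s -> (C `&` int_lattice) x)
      & no_n_dependent s]].

End Defs.

(* Main.v *)
(* Let lam_i be the successive minima, P the minimum over m and
   B = (1 - lam_n) P / (16 n^2). Choose independent lattice points b_i in
   lam_i C, and a prime p with B <= p < 4 B. For each t modulo p, the pigeonhole
   principle applied to the p multiples of (1, t, ..., t^(n-1)) modulo p gives
   an integer vector c_t congruent to a nonzero multiple of it, with
   |c_{t,i}| <= s_i, as soon as the box sizes s_i satisfy
   prod_i ceil(p / (s_i + 1)) < p. The bounds on products of lam_i allow such
   s_i with sum_i s_i lam_i <= 1, so that x_t = sum_i c_{t,i} b_i lies in C by
   convexity. Any n of the p points x_t are independent because the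
   determinant of their coordinates is nonzero modulo p, by Vandermonde. *)

Require Import Defs.
From HB Require Import structures.
From mathcomp Require Import all_boot all_order all_algebra.
From mathcomp Require Import all_classical all_reals all_analysis.
From mathcomp Require Import zify ring lra.

Set Implicit Arguments.
Unset Strict Implicit.
Unset Printing Implicit Defensive.

Import Order.TTheory GRing.Theory Num.Theory.
Import numFieldNormedType.Exports.

Local Open Scope classical_set_scope.
Local Open Scope ring_scope.

(** * A prime between n and 4n *)

Section WeakBertrand.
Local Open Scope nat_scope.

Lemma prod_primes_dvdn m n N :
  (forall p, prime p -> m <= p < n -> p %| N) ->
  \prod_(m <= p < n | prime p) p %| N.
Proof.
elim: n => [|n IHn] dvN; first by rewrite big_geq ?dvd1n.
case: (leqP m n) => [le_mn|lt_nm]; last by rewrite big_geq ?dvd1n.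
rewrite big_mkcond big_nat_recr //= -big_mkcond /=.
have dvP : \prod_(m <= p < n | prime p) p %| N.
  by apply: IHn => p pp /andP[mp pn]; apply: dvN; rewrite // mp ltnS ltnW.
case: ifP => pn; last by rewrite muln1.
rewrite Gauss_dvd ?dvP ?dvN ?le_mn ?ltnSn //.
rewrite coprime_sym big_nat_cond prime_coprime //.
apply: (big_ind (fun x => ~~ (n %| x))).
- by rewrite dvdn1; case: (n) pn => [|[]].
- by move=> x y nx ny; rewrite Euclid_dvdM // negb_or nx.
- by move=> p /andP[/andP[_ lpn] pp]; rewrite gtnNdvd ?prime_gt0.
Qed.

(** The equal coefficients at m and m + 1 both occur in the expansion of (1 + 1)^(2m+1). *)
Lemma bin_odd_le m : 'C(m.*2.+1, m) <= 4 ^ m.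
Proof.
have := leq_pmul2l (m := 2) isT => <-; rewrite -[2 * 4 ^ m]/(2 * (2 ^ 2) ^ m) -expnM -expnS.
have -> : 2 ^ (2 * m).+1 = \sum_(i < m.*2.+2) 'C(m.*2.+1, i).
  by rewrite mul2n -[2]/(1 + 1) expnDn; apply: eq_bigr => i _; rewrite !exp1n !muln1.
have m1 : m < m.*2.+2 by lia.
have m2 : m.+1 < m.*2.+2 by lia.
rewrite (bigD1 (Ordinal m1)) //= (bigD1 (Ordinal m2)) /=; last first.
  by rewrite -val_eqE /= eqn_leq ltnn.
have <- : 'C(m.*2.+1, m.*2.+1 - m) = 'C(m.*2.+1, m.+1) by congr binomial; lia.
rewrite bin_sub; last by lia.
by rewrite addnA mul2n -addnn leq_addr.
Qed.

Lemma prime_dvdn_fact p n : prime p -> (p %| n`!) = (p <= n).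
Proof.
move=> pp; apply/idP/idP => [|le_pn]; last by rewrite dvdn_fact // prime_gt0.
elim: n => [|n IHn]; first by rewrite fact0 dvdn1; case: p pp => [|[]].
rewrite factS Euclid_dvdM // => /orP[/dvdn_leq-> //|/IHn]; exact: leqW.
Qed.

(** Strong induction. An even number above 2 adds no prime. For 2m + 1, the primes from m + 2 on
    divide ['C(m.*2.+1, m)], which is at most 4^m, and those up to m + 1 contribute at most
    4^(m+1). *)
Lemma primorial_le n : \prod_(0 <= p < n.+1 | prime p) p <= 4 ^ n.
Proof.
have [k] := ubnP n; elim: k n => // k IHk [|[|[|n]]] ltnk.
- by rewrite big_mkcond !big_nat_recr //= big_geq.
- by rewrite big_mkcond !big_nat_recr //= big_geq.
- by rewrite big_mkcond !big_nat_recr //= big_geq.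
case: (boolP (odd n)) => [odd_n|even_n].
  rewrite big_mkcond big_nat_recr //= ifN; last first.
    by apply/negP => /even_prime[|] //=; rewrite odd_n.
  rewrite -big_mkcond muln1; apply: leq_trans (IHk n.+2 _) _; first by lia.
  by rewrite leq_exp2l.
have [m def_n] : exists m, n.+3 = m.*2.+1.
  by exists n./2.+1; rewrite -{1}(odd_double_half n) (negbTE even_n).
rewrite def_n.
rewrite (@big_cat_nat _ _ _ m.+2) //=; last by lia.
have ->: 4 ^ m.*2.+1 = 4 ^ m.+1 * 4 ^ m by rewrite -expnD; congr expn; lia.
apply: leq_mul; first by apply: IHk; lia.
apply: leq_trans (bin_odd_le m).
apply: dvdn_leq; first by rewrite bin_gt0; lia.
apply: prod_primes_dvdn => p pp /andP[mp pm].
have le_m : m <= m.*2.+1 by lia.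
have : p %| (m.*2.+1)`! by rewrite prime_dvdn_fact //; lia.
rewrite -(bin_fact le_m) !Euclid_dvdM // !prime_dvdn_fact //.
by case/or3P => // ?; lia.
Qed.

(** By Legendre's formula the exponent is the sum over k of floor(2N / p^k) - 2 floor(N / p^k); each
    term is at most 1 and vanishes once p^k > 2N. *)
Lemma logn_central_bin_le p N :
  prime p -> logn p 'C(N.*2, N) <= trunc_log p N.*2.
Proof.
move=> pp; have p_gt1 := prime_gt1 pp.
have le_N : N <= N.*2 by lia.
have := congr1 (logn p) (bin_fact le_N).
have -> : N.*2 - N = N by lia.
rewrite !lognM ?muln_gt0 ?fact_gt0 ?bin_gt0 //.
have -> : logn p N`! = \sum_(1 <= k < N.*2.+1) N %/ p ^ k.
  rewrite logn_fact // [RHS](@big_cat_nat _ _ _ N.+1) //=.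
  rewrite [X in _ = _ + X]big_nat_cond [X in _ = _ + X]big1 ?addn0 // => k.
  by rewrite andbT => /andP[Nk _]; rewrite divn_small // (leq_trans Nk) // ltnW // ltn_expl.
rewrite logn_fact // -big_split /= => eq_log.
have: \sum_(1 <= k < N.*2.+1) N.*2 %/ p ^ k <=
  \sum_(1 <= k < N.*2.+1) ((k <= trunc_log p N.*2) + (N %/ p ^ k + N %/ p ^ k)).
  apply: leq_sum => k _; case: (leqP k) => [_|lt_k].
    have q_gt0 : 0 < p ^ k by rewrite expn_gt0 prime_gt0.
    rewrite -ltnS ltn_divLR //.
    by have := divn_eq N (p ^ k); have := ltn_pmod N q_gt0; nia.
  rewrite divn_small //; apply: leq_trans (trunc_log_ltn _ p_gt1) _.
  by rewrite leq_exp2l.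
rewrite big_split /= -eq_log leq_add2r => /leq_trans; apply.
have -> M T : \sum_(1 <= k < M.+1) (k <= T : nat) = minn M T.
  elim: M => [|M IHM]; first by rewrite big_geq ?min0n.
  by rewrite big_nat_recr //= IHM; lia.
exact: geq_minr.
Qed.

(** Induction from (N + 1) C(2N+2, N+1) = 2 (2N + 1) C(2N, N), bounding 2N + 1 below by 2N. *)
Lemma central_bin_ge N : 0 < N -> 4 ^ N <= N.*2 * 'C(N.*2, N).
Proof.
case: N => // N _; elim: N => [|N IHN] //.
rewrite expnS; apply: leq_trans (_ : 4 * (N.+1.*2 * 'C(N.+1.*2, N.+1)) <= _).
  by rewrite leq_mul2l.
have e1 := mul_bin_diag N.+2.*2 N.+1; have e2 := mul_bin_left N.+2.*2.-1 N.+1.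
have e3 := mul_bin_down N.+2.*2.-1 N.+1.
have -> : N.+2.*2 * 'C(N.+2.*2, N.+2) = 2 * (N.+2.*2 * 'C(N.+2.*2.-1, N.+1)).
  by rewrite e1; lia.
move: e3; rewrite (_ : N.+2.*2.-1.-1 = N.+1.*2) 1?(_ : N.+2.*2.-1 - N.+1 = N.+2); [|lia|lia].
by move: 'C(_, _) 'C(_, _) => a b; nia.
Qed.

(** In the prime factorization each prime power is at most 2N, and p has exponent at most 1 when p^2
    > 2N. *)
Lemma central_bin_le n N : 0 < N -> n <= N.*2 ->
  (forall p, prime p -> n < p -> ~~ (p <= N.*2)) ->
  'C(N.*2, N) <= \prod_(0 <= p < n.+1 | prime p) (if p * p <= N.*2 then N.*2 else p).
Proof.
move=> N_gt0 le_nN no_p; set c := 'C(_, _).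
have c_gt0 : 0 < c by rewrite bin_gt0; lia.
have T_le p : prime p -> p ^ logn p c <= (if p * p <= N.*2 then N.*2 else p).
  move=> pp; have lelog := logn_central_bin_le N pp.
  have leT : p ^ trunc_log p N.*2 <= N.*2 by rewrite trunc_logP ?prime_gt1 //; lia.
  case: ifP => [le_pN|/negbT].
    by apply: leq_trans leT; rewrite leq_exp2l ?prime_gt1.
  rewrite -ltnNge => lt_Np; rewrite -[leqRHS]expn1 leq_exp2l ?prime_gt1 //.
  apply: leq_trans lelog _; rewrite -ltnS.
  by rewrite -(ltn_exp2l _ _ (prime_gt1 pp)) (leq_ltn_trans leT).
have out p : prime p -> n < p -> logn p c = 0.
  move=> pp lt_np; apply/eqP; rewrite -leqn0; apply: leq_trans (logn_central_bin_le N pp) _.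
  by rewrite leqn0 trunc_log_eq0; have := no_p _ pp lt_np; lia.
have -> : c = \prod_(0 <= p < n.+1 | prime p) p ^ logn p c.
  rewrite -{1}(partnT c_gt0) (@widen_partn (maxn n c)) ?leq_maxr //.
  rewrite (@big_cat_nat _ _ _ n.+1) ?ltnS ?leq_maxl //=.
  rewrite [X in _ * X]big_nat_cond [X in _ * X]big1 ?muln1; last first.
    move=> p /andP[/andP[lt_np _] _]; case: (boolP (prime p)) => [pp|np].
      by rewrite out.
    by rewrite lognE (negbTE np).
  rewrite [RHS]big_mkcond; apply: eq_bigr => p _; case: ifP => // np.
  by rewrite lognE np.
by apply: leq_prod => p; apply: T_le.
Qed.

Lemma exp2_gt_quartic r : 17 <= r -> r.+1 ^ 4 < 2 ^ r.
Proof.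
elim: r => // r IHr; rewrite leq_eqVlt => /predU1P[<-|].
  by vm_compute.
rewrite ltnS => r17; have lt_r := IHr r17; rewrite [2 ^ _]expnS.
have : r.+2 ^ 4 <= 2 * r.+1 ^ 4.
  by rewrite !expnS expn0; nia.
by move/leq_ltn_trans; apply; rewrite ltn_pmul2l.
Qed.

(* Erdos' argument: without primes in ]n, 4n[, the central binomial coefficient
   'C(4n, 2n) would be at most (4n)^(sqrt(4n)) times the primorial of n. *)
Lemma prime_between n : 0 < n -> exists p, [/\ prime p, n < p & p < 4 * n].
Proof.
move=> n_gt0.
(* Beyond 72, 4n >= 292 > 17^2, so the integer square root [r] below is at least 17, as
   [exp2_gt_quartic] requires. *)
case: (leqP n 72) => [n_small|n_big].
  case: (leqP n 1) => ?; first by exists 2; split => //; lia.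
  case: (leqP n 4) => ?; first by exists 5; split => //; lia.
  case: (leqP n 16) => ?; first by exists 17; split => //; lia.
  case: (leqP n 66) => ?; first by exists 67; split => //; lia.
  by exists 73; split => //; lia.
pose P p := [&& prime p, n < p & p < 4 * n].
have [/hasP[p _ /and3P[? ? ?]]|/hasPn noP] := boolP (has P (iota 0 (4 * n).+1)).
  by exists p.
have no_p p : prime p -> n < p -> ~~ (p <= n.*2.*2).
  move=> pp lt_np; apply/negP => le_p.
  have /noP : p \in iota 0 (4 * n).+1 by rewrite mem_iota; lia.
  by rewrite /P pp lt_np /=; case: (even_prime pp); lia.
have lo := central_bin_ge (N := n.*2) ltac:(lia).
have hi := @central_bin_le n n.*2 ltac:(lia) ltac:(lia) no_p.
have [r r_le r_max] : exists2 r, r * r <= n.*2.*2 & n.*2.*2 < r.+1 * r.+1.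
  have ex0 : exists r, r * r <= n.*2.*2 by exists 0.
  have ub r : r * r <= n.*2.*2 -> r <= n.*2.*2 by nia.
  case: (ex_maxnP ex0 ub) => r r_le r_max; exists r => //.
  by rewrite ltnNge; apply/negP => /r_max; rewrite ltnn.
have r17 : 17 <= r by nia.
(* The primes with p^2 <= 4n lie among 2, ..., r, so there are at most r - 1 of them; the primorial
   bounds the remaining factors. *)
have hi2 : \prod_(0 <= p < n.+1 | prime p)
     (if p * p <= n.*2.*2 then n.*2.*2 else p) <= n.*2.*2 ^ (r - 1) * 4 ^ n.
  apply: leq_trans (_ : (\prod_(0 <= p < n.+1 | prime p)
     if p * p <= n.*2.*2 then n.*2.*2 else 1) * (\prod_(0 <= p < n.+1 | prime p) p) <= _).
    rewrite -big_split /=; apply: leq_prod => p pp.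
    by case: ifP => _; rewrite ?mul1n // leq_pmulr ?prime_gt0.
  apply: leq_mul; last exact: primorial_le.
  rewrite -big_mkcondr /= -big_filter.
  set s := [seq _ <- _ | _].
  rewrite big_const_seq count_predT iter_muln_1 leq_exp2l; last by lia.
  rewrite -(size_iota 2 (r - 1)); apply: uniq_leq_size.
    by rewrite filter_uniq ?iota_uniq.
  move=> p; rewrite mem_filter mem_iota => /andP[/andP[/prime_gt1 p1 pN] _].
  by rewrite p1 /=; nia.
have key : 4 ^ n <= n.*2.*2 ^ r.
  have e : 4 ^ n.*2 = 4 ^ n * 4 ^ n by rewrite -addnn expnD.
  have e2 : n.*2.*2 ^ r = n.*2.*2 * n.*2.*2 ^ (r - 1).
    by rewrite -expnS; congr expn; lia.
  have p0 : 0 < 4 ^ n by rewrite expn_gt0.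
  rewrite -(leq_pmul2r p0) -e; apply: leq_trans lo _.
  by rewrite e2 -mulnA leq_mul2l; apply/orP; right; apply: leq_trans hi hi2.
(* Compare r-th powers: 2^(r^2) <= 2^(4n) <= (4n)^(2r) <= (r+1)^(4r). *)
have : 2 ^ r <= r.+1 ^ 4.
  rewrite -(@leq_exp2r _ _ r); last by lia.
  rewrite -!expnM; apply: leq_trans (_ : (4 ^ n) ^ 2 <= _).
    by rewrite -[4]/(2 ^ 2) -!expnM leq_exp2l //; lia.
  apply: leq_trans (_ : (n.*2.*2 ^ r) ^ 2 <= _); first by rewrite leq_exp2r.
  apply: leq_trans (_ : ((r.+1 * r.+1) ^ r) ^ 2 <= _).
    by rewrite !leq_exp2r //; lia.
  by rewrite mulnn -!expnM leq_exp2l //; lia.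
by rewrite leqNgt exp2_gt_quartic.
Qed.
End WeakBertrand.

(** * Small multiples of vectors modulo a prime *)

(** Cut the residues in coordinate i into intervals of length s_i + 1. The p multiples of [v] fall
    into fewer than p boxes, so two share a box; [c] is the difference of their representatives. *)
Lemma small_multiple (p n : nat) (s : 'I_n -> nat) (v : 'I_n -> 'F_p) :
  prime p -> (\prod_i (p.-1 %/ (s i).+1).+1 < p)%N ->
  exists (a : 'F_p) (c : 'I_n -> int), a != 0 /\
    forall i, (c i)%:~R = a * v i /\ (`|c i| <= s i)%N.
Proof.
move=> pp small.
pose K i := (p.-1 %/ (s i).+1).+1.
pose f (a : 'F_p) : fprod (fun i => 'I_(K i)) :=
  [fprod i => inord (nat_of_ord (a * v i)%R %/ (s i).+1)%N].
have /injectivePn[a [a' neq_aa' eq_f]] : ~~ injectiveb f.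
  apply/negP => /injectiveP /leq_card; rewrite card_Fp // card_fprod leqNgt.
  by under eq_bigr do rewrite card_ord; rewrite small.
exists (a - a'), (fun i => (nat_of_ord (a * v i))%:Z - (nat_of_ord (a' * v i))%:Z).
split=> [|i]; first by rewrite subr_eq0.
split; first by rewrite intrB -!pmulrn (natr_Zp (a * v i)) (natr_Zp (a' * v i)) mulrBl.
have lt_p (x : 'F_p) : (x < p)%N by rewrite -[X in (_ < X)%N](Fp_cast pp).
have lt_K (x : 'F_p) : (x %/ (s i).+1 < K i)%N.
  by rewrite ltnS leq_div2r //; have := lt_p x; have := prime_gt0 pp; lia.
have := congr1 (fun g : fprod (fun i => 'I_(K i)) => nat_of_ord (g i)) eq_f.
rewrite !fprodE !inordK //.
move: (nat_of_ord (a * v i)) (nat_of_ord (a' * v i)) => x y.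
have := divn_eq x (s i).+1; have := divn_eq y (s i).+1.
have := ltn_pmod x (ltn0Sn (s i)); have := ltn_pmod y (ltn0Sn (s i)).
move=> lt_y lt_x def_y + eq_q; rewrite {}eq_q => def_x.
move: (y %/ _ * _)%N (x %% _)%N (y %% _)%N lt_x lt_y def_x def_y; clear.
by move=> m r r'; lia.
Qed.

(** Modulo p the matrix is an invertible diagonal matrix times a transposed Vandermonde matrix with
    distinct nodes, so its integer determinant is nonzero. *)
Lemma unitmx_moment (R : numFieldType) (p n : nat) (t a : 'I_n -> 'F_p)
    (c : 'I_n -> 'I_n -> int) :
  prime p -> injective t -> (forall j, a j != 0) ->
  (forall j i, (c j i)%:~R = a j * t j ^+ i) ->
  (\matrix_(j, i) (c j i)%:~R : 'M[R]_n) \in unitmx.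
Proof.
move=> pp inj_t a_neq0 cE; pose M : 'M[int]_n := \matrix_(j, i) c j i.
have detM : \det (map_mx intr M : 'M['F_p]_n) != 0.
  have -> : map_mx intr M =
      diag_mx (\row_j a j) *m (Vandermonde n (\row_j t j))^T.
    by apply/matrixP => j i; rewrite mul_diag_mx !mxE cE.
  rewrite det_mulmx det_diag det_tr det_Vandermonde mulf_neq0 //.
    by apply/prodf_neq0 => j _; rewrite mxE.
  apply/prodf_neq0 => i _; apply/prodf_neq0 => j lt_ij; rewrite !mxE subr_eq0.
  by rewrite (inj_eq inj_t) -val_eqE gtn_eqF.
have -> : \matrix_(j, i) (c j i)%:~R = map_mx intr M :> 'M[R]_n.
  by apply/matrixP => j i; rewrite !mxE.
rewrite unitmxE unitfE det_map_mx intr_eq0; apply: contraNneq detM => detM0.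
by rewrite det_map_mx detM0 rmorph0.
Qed.

(** * Box sizes from the products of the minima *)

Section BoxSizes.
Variables (R : realType) (n p : nat) (lam : nat -> R) (P : R).
Hypotheses (n_ge2 : (2 <= n)%N) (p_gt1 : (1 < p)%N).
Hypothesis lam_gt0 : forall i, (0 < i <= n)%N -> 0 < lam i.
Hypothesis lam_homo : forall i j, (0 < i)%N -> (i <= j <= n)%N -> lam i <= lam j.
Hypothesis lam_n_le1 : lam n <= 1.
Hypothesis P_gt0 : 0 < P.
Hypothesis P_le : forall m, (0 < m < n)%N ->
  P ^+ (n - m) * \prod_(m <= i < n.+1) lam i <= 1.
(** With B = (1 - lam_n) P / (16 n^2) this reads p < 4 B. *)
Hypothesis p_lt : p%:R * (4 * n%:R ^+ 2) < (1 - lam n) * P.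

(** The first condition keeps the combinations with |c_i| <= s_i inside the body; the second is the
    pigeonhole condition of [small_multiple]. *)
Let box_ok (s : nat -> nat) :=
  \sum_(1 <= i < n.+1) (s i)%:R * lam i <= 1 /\
  (\prod_(1 <= i < n.+1) (p.-1 %/ (s i).+1).+1 < p)%N.

(* Here P lam_(n-1) <= n, so the first n - 1 coordinates can be left
   unrestricted modulo p, while the last one is only halved. *)
Lemma box_sizes_large : n%:R^-1 < lam n -> exists s, box_ok s.
Proof.
move=> lam_n; have n_gt0 : 0 < n%:R :> R by rewrite ltr0n; lia.
have ln0 : 0 < lam n by apply: lam_gt0; lia.
have n1 : (0 < n.-1 < n)%N by lia.
have l0 : 0 < lam n.-1 by apply: lam_gt0; lia.
have p_gt0 : 0 < p%:R :> R by rewrite ltr0n; lia.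
have nE : n = n.-1.+1 by lia.
(* The case m = n - 1 gives P lam_(n-1) lam_n <= 1, and lam_n > 1/n. *)
have Pl : P * lam n.-1 <= n%:R.
  have := P_le n1; have -> : (n - n.-1 = 1)%N by lia.
  rewrite expr1 big_ltn; last by lia.
  rewrite -nE big_nat1 mulrA => Pll.
  have : n%:R^-1 * (P * lam n.-1) <= lam n * (P * lam n.-1).
    by rewrite ler_pM2r ?mulr_gt0 // ltW.
  rewrite [leRHS]mulrC => /le_trans/(_ Pll).
  by rewrite mulrC ler_pdivrMr // mul1r.
have plam : n%:R * p%:R * lam n.-1 <= 1 - lam n.
  have h1 : p%:R * (4 * n%:R ^+ 2) * lam n.-1 <= (1 - lam n) * P * lam n.-1.
    by rewrite ler_pM2r // ltW.
  have h2 : (1 - lam n) * (P * lam n.-1) <= (1 - lam n) * n%:R.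
    by rewrite ler_wpM2l // subr_ge0.
  have h3 : n%:R * p%:R * lam n.-1 * n%:R <= (1 - lam n) * n%:R.
    have : 0 <= n%:R * p%:R * lam n.-1 * n%:R by rewrite !mulr_ge0 // ltW.
    nra.
  by rewrite ler_pM2r in h3.
clear Pl l0 P_le p_lt lam_n P_gt0.
exists (fun i => if i == n then 1%N else p.-1); split; last first.
  clear plam ln0 p_gt0 n_gt0 lam_gt0 lam_homo lam_n_le1.
  rewrite nE big_nat_recr /=; last by lia.
  rewrite -nE eqxx big_nat_cond big1 ?mul1n; first by lia.
  move=> i /andP[/andP[i0 ltin] _]; rewrite ifN; last by lia.
  by rewrite divn_small //; lia.

rewrite nE big_nat_recr /=; last by move: nE; clear; lia.
rewrite -nE eqxx mul1r -lerBrDr; apply: le_trans plam.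
rewrite big_nat_cond.
apply: le_trans (_ : \sum_(1 <= i < n | (0 < i < n)%N && true) p%:R * lam n.-1 <= _).
  apply: ler_sum => i /andP[/andP[i0 ltin] _]; rewrite ifN ?ltn_eqF //.
  apply: ler_pM => //; first by apply/ltW/lam_gt0; rewrite i0 ltnW.
    by rewrite ler_nat leq_pred.
  by apply: lam_homo => //; rewrite leq_pred andbT -ltnS -nE.
rewrite -big_nat_cond sumr_const_nat -(mulr_natl (p%:R * _)) mulrA.
rewrite ler_wpM2r ?ler_wpM2r ?ler0n //; first by apply/ltW/lam_gt0; move: nE n_ge2; clear; lia.
by rewrite ler_nat leq_subr.
Qed.

(* With s_i = floor (1 / (n lam_i)), only the coordinates from some m on are
   restricted, and each contributes a factor at most 2 p n lam_i. *)
Lemma box_sizes_small : lam n <= n%:R^-1 -> exists s, box_ok s.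
Proof.
move=> lam_n; have n_gt0 : 0 < n%:R :> R by rewrite ltr0n; lia.
have p_gt0 : 0 < p%:R :> R by rewrite ltr0n; lia.
pose s i := Num.truncn (n%:R * lam i)^-1.
have nl_gt0 i : (0 < i <= n)%N -> 0 < n%:R * lam i.
  by move=> i_in; rewrite mulr_gt0 ?lam_gt0.
have s_itv i : (0 < i <= n)%N ->
    (s i)%:R <= (n%:R * lam i)^-1 < (s i).+1%:R.
  by move=> i_in; apply: truncn_itv; rewrite invr_ge0 ltW ?nl_gt0.
(* This is where lam_n <= 1/n enters; it settles the case m = n below, which [P_le] does not
   cover. *)
have s_n : (0 < s n)%N.
  have n_in : (0 < n <= n)%N by lia.
  have /andP[_ lt_s] := s_itv _ n_in.
  rewrite -ltnS -(ltr_nat R); apply: le_lt_trans lt_s.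
  by rewrite invf_ge1 ?nl_gt0 // mulrC -ler_pdivlMr // mul1r.
have s_anti i j : (0 < i)%N -> (i <= j <= n)%N -> (s j <= s i)%N.
  move=> i0 ijn; apply: le_truncn; rewrite lef_pV2 ?posrE ?nl_gt0 //; try lia.
  by rewrite ler_pM2l // lam_homo.
exists s; split.
  apply: le_trans (_ : \sum_(1 <= i < n.+1) n%:R^-1 <= _).
    rewrite !big_nat; apply: ler_sum => i i_in.
    rewrite -ler_pdivlMr ?lam_gt0 // -invfM.
    by have /andP[] := s_itv _ i_in.
  by rewrite sumr_const_nat subn1 /= -(mulr_natl n%:R^-1) mulfV ?gt_eqF.
pose K i := (p.-1 %/ (s i).+1).+1; rewrite -/(K _).
have K1 i : (p <= (s i).+1)%N -> K i = 1%N.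
  by move=> le_ps; rewrite /K divn_small //; lia.
(* K_i (s_i + 1) <= (p - 1) + (s_i + 1) < 2p, and s_i + 1 > 1 / (n lam_i). *)
have K_le i : (0 < i <= n)%N -> ((s i).+1 < p)%N -> (K i)%:R <= 2 * p%:R * n%:R * lam i.
  move=> i_in lt_sp; have /andP[_ lt_s] := s_itv _ i_in.
  have le_K : (K i * (s i).+1 <= 2 * p)%N.
    by rewrite /K mulSn; have := leq_trunc_div p.-1 (s i).+1; lia.
  rewrite -mulrA -ler_pdivrMr ?nl_gt0 //.
  apply: le_trans (_ : (K i)%:R * (s i).+1%:R <= _).
    by rewrite ler_pM2l ?ltr0n // ltW.
  by rewrite -!natrM ler_nat.
case: (boolP (has (fun i => ((s i).+1 < p)%N) (iota 1 n))) => [|/hasPn noK]; last first.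
  rewrite big_nat_cond big1 // => i /andP[i_in _]; apply: K1.
  by rewrite leqNgt noK // mem_iota.
move=> exK.
have ex0 : exists m, [&& (0 < m)%N, (m <= n)%N & ((s m).+1 < p)%N].
  by case/hasP: exK => i; rewrite mem_iota => /andP[? ?] ?; exists i; apply/and3P; split => //; lia.
(* By minimality all factors before [m] are 1; since [s] is nonincreasing, every index from [m] on
   satisfies s_i + 1 < p. *)
case: (ex_minnP ex0) => m /and3P[m_gt0 le_mn lt_sp] m_min.
have prodE : (\prod_(1 <= i < n.+1) K i = \prod_(m <= i < n.+1) K i)%N.
  rewrite (@big_cat_nat _ _ _ m) ?(leqW le_mn) //=.
  rewrite big_nat_cond big1 ?mul1n // => i /andP[/andP[i0 lt_im] _].
  apply: K1; rewrite leqNgt; apply/negP => lt_s; move: (lt_im).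
  by rewrite ltnNge m_min // i0 lt_s andbT (leq_trans (ltnW lt_im)).
rewrite prodE; case: (ltngtP m n) => [lt_mn||->]; [|by lia|]; last first.
  rewrite big_nat1 /K; apply: leq_ltn_trans (_ : (p.-1 %/ 2).+1 < p)%N; last by lia.
  by rewrite ltnS leq_div2l.
rewrite -(ltr_nat R) natr_prod.
have m_in : (0 < m < n)%N by lia.
have -> : p%:R = p%:R * P ^+ (n - m) / P ^+ (n - m) :> R.
  by rewrite mulfK // expf_neq0 // gt_eqF.
rewrite ltr_pdivlMr ?exprn_gt0 //.
have le_prod : \prod_(m <= i < n.+1) (K i)%:R <=
    (2 * p%:R * n%:R) ^+ (n - m).+1 * \prod_(m <= i < n.+1) lam i.
  have -> : (n - m).+1 = (n.+1 - m)%N by lia.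
  rewrite -prodr_const_nat -big_split /= !big_nat; apply: ler_prod => i i_in.
  rewrite ler0n K_le //; first by lia.
  by apply: leq_ltn_trans lt_sp; rewrite ltnS s_anti //; lia.
apply: le_lt_trans (_ : (2 * p%:R * n%:R) ^+ (n - m).+1 < _).
  rewrite -[leRHS]mulr1; apply: le_trans (ler_pM _ _ le_prod (lexx _)) _.
  - by rewrite prodr_ge0.
  - by rewrite exprn_ge0 // ltW.
  by rewrite -(mulrA (_ ^+ _)) ler_wpM2l ?exprn_ge0 ?mulr_ge0 // mulrC P_le.
have P_big : p%:R * (4 * n%:R ^+ 2) < P.
  apply: lt_le_trans p_lt _; rewrite ler_piMl ?(ltW P_gt0) //.
  by rewrite lerBlDr lerDl; apply/ltW/lam_gt0; lia.
(* Since n - m >= 1, (2n)^(n-m+1) <= (4n^2)^(n-m); strictness comes from 4 n^2 p < P. *)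
apply: le_lt_trans (_ : p%:R * (p%:R * (4 * n%:R ^+ 2)) ^+ (n - m) < _); last first.
  by rewrite ltr_pM2l // ltrXn2r ?mulr_ge0 ?sqr_ge0 // subn_eq0 -ltnNge.
have -> : 4 * n%:R ^+ 2 = (2 * n%:R) ^+ 2 :> R by rewrite exprMn; congr (_ * _); ring.
rewrite (_ : 2 * p%:R * n%:R = p%:R * (2 * n%:R)); last by ring.
have X_ge1 : 1 <= 2 * n%:R :> R by rewrite -natrM ler1n; lia.
move: (2 * n%:R) X_ge1 => X X_ge1.
rewrite !(exprMn _ p%:R) [p%:R ^+ _.+1]exprS -!mulrA ler_pM2l // ler_pM2l ?exprn_gt0 //.
by rewrite -exprM ler_weXn2l //; lia.
Qed.

Lemma box_sizes : exists s : nat -> nat,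
  \sum_(1 <= i < n.+1) (s i)%:R * lam i <= 1 /\
  (\prod_(1 <= i < n.+1) (p.-1 %/ (s i).+1).+1 < p)%N.
Proof.
by case: (leP (lam n) n%:R^-1) => [/box_sizes_small|/box_sizes_large].
Qed.
End BoxSizes.

(** * Lattice points in general position *)

Lemma span_set_sub (K : fieldType) (V : vectType K) (A : set V) (W : {vspace V}) :
  (forall v, A v -> v \in W) -> (span_set A <= W)%VS.
Proof.
by rewrite /span_set; case: xgetP => [U _ [_ UW] /UW|_ _] //; exact: sub0v.
Qed.

(** Greedy choice: the span of A_(n+1) has dimension above n, so A_(n+1) is not contained in the
    span of the n vectors already chosen. *)
Lemma free_system (K : fieldType) (V : vectType K) (A : nat -> set V) (n : nat) :
  (forall i, (0 < i <= n)%N -> (i <= \dim (span_set (A i)))%N) ->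
  exists s : seq V, [/\ size s = n, free s &
    forall i, (i < n)%N -> A i.+1 (nth 0 s i)].
Proof.
elim: n => [|n IHn] dimA; first by exists [::]; rewrite nil_free.
have [i /andP[i0 lein]|s [size_s free_s sA]] := IHn.
  by apply: dimA; rewrite i0 leqW.
have [v Av v_s] : exists2 v, A n.+1 v & v \notin << s >>%VS.
  apply: contrapT => noV; have /dimvS : (span_set (A n.+1) <= << s >>)%VS.
    apply: span_set_sub => v Av; apply/negPn/negP => v_s.
    by apply: noV; exists v.
  move/(leq_trans (dimA n.+1 (ltnSn n)))/leq_trans/(_ (dim_span s)).
  by rewrite size_s ltnn.
exists (rcons s v); split; first by rewrite size_rcons size_s.
  by rewrite (perm_free (permEl (perm_rcons v s))) free_cons v_s.
move=> i; rewrite ltnS nth_rcons size_s leq_eqVlt => /predU1P[->|lt_in].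
  by rewrite ltnn eqxx.
by rewrite lt_in; apply: sA.
Qed.

Lemma free_rows_unitmx (K : fieldType) (n : nat) (s : n.-tuple 'rV[K]_n) :
  free s = ((\matrix_(i < n) s`_i) \in unitmx).
Proof.
have mulE v : v *m (\matrix_(i < n) s`_i) = \sum_(i < n) v 0 i *: s`_i.
  by rewrite mulmx_sum_row; apply: eq_bigr => i _; rewrite rowK.
apply/freeP/idP => [free_s|unit_s k k0 i].
  rewrite -row_free_unit; apply: inj_row_free => v; rewrite mulE => v0.
  by apply/rowP => i; rewrite mxE; apply: (free_s (v 0)).
have : (\row_j k j) *m (\matrix_(i < n) s`_i) = 0.
  by rewrite mulE -[RHS]k0; apply: eq_bigr => j _; rewrite mxE.
move/(congr1 (mulmx^~ (invmx (\matrix_(i < n) s`_i)))); rewrite mulmxK // mul0mx.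
by move/rowP/(_ i); rewrite !mxE.
Qed.

Section SymmetricConvex.
Variables (R : realType) (n : nat) (C : set 'rV[R]_n).
Hypotheses (convC : @convex_set R 'rV[R]_n C) (symC : origin_symmetric C).

Lemma convex_combination x y (t : R) : C x -> C y -> 0 <= t -> t <= 1 ->
  C (t *: x + (1 - t) *: y).
Proof.
move=> Cx Cy t0 t1.
by have := convC (Itv01 t0 t1) (mem_set Cx) (mem_set Cy); rewrite inE.
Qed.

Lemma symmetric_convex0 x : C x -> C 0.
Proof.
move=> Cx; have := @convex_combination _ _ 2^-1 Cx (symC Cx).
rewrite (_ : 1 - 2^-1 = 2^-1); last by lra.
by rewrite scalerN subrr; apply; lra.
Qed.

Lemma symmetric_convex_sum (I : Type) (r : seq I) (w : I -> R) (y : I -> 'rV[R]_n) :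
  C 0 -> (forall i, C (y i)) -> \sum_(i <- r) `|w i| <= 1 ->
  C (\sum_(i <- r) w i *: y i).
Proof.
move=> C0 Cy.
(* The bound 1 is generalized to any W because the tail of the sum is left with W - |w_i|. Symmetry
   absorbs the signs of the weights. *)
suff H W : \sum_(i <- r) `|w i| <= W ->
    exists2 z, C z & \sum_(i <- r) w i *: y i = W *: z.
  by move/H => [z Cz ->]; rewrite scale1r.
elim: r W => [|i r IHr] W; first by exists 0; rewrite // big_nil scaler0.
rewrite !big_cons -lerBrDl => le_W; have [z Cz ->] := IHr _ le_W.
have W1_ge0 : 0 <= W - `|w i| by apply: le_trans le_W; apply: sumr_ge0.
have [y' Cy' ->] : exists2 y', C y' & w i *: y i = `|w i| *: y'.
  case: (ger0P (w i)) => _; first by exists (y i).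
  by exists (- y i); [exact: symC | rewrite scalerN scaleNr opprK].
have := normr_ge0 (w i); move: `|w i| W1_ge0 => a Wa a0.
have [W0|W_neq0] := eqVneq W 0.
  have -> : a = 0 by lra.
  by exists z; rewrite // scale0r add0r subr0.
have W_gt0 : 0 < W by rewrite lt_neqAle eq_sym W_neq0; lra.
exists (a / W *: y' + (1 - a / W) *: z).
  apply: convex_combination => //; first by rewrite divr_ge0 // ltW.
  by rewrite ler_pdivrMr //; lra.
by rewrite scalerDr !scalerA mulrBr mulr1 mulrCA mulfV // mulr1.
Qed.

Lemma general_position_points (lam : nat -> R) (s : nat -> nat) (p : nat) :
  C 0 -> (2 <= n)%N -> prime p ->
  (forall i, (0 < i <= n)%N -> 0 < lam i /\
    (i <= \dim (span_set ([set lam i *: x | x in C] `&` int_lattice)))%N) ->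
  \sum_(1 <= i < n.+1) (s i)%:R * lam i <= 1 ->
  (\prod_(1 <= i < n.+1) (p.-1 %/ (s i).+1).+1 < p)%N ->
  exists r : seq 'rV[R]_n, [/\ uniq r, size r = p,
    (forall x, x \in r -> (C `&` int_lattice) x) & no_n_dependent r].
Proof.
move=> C0 n_ge2 pp lamP sum_le prod_lt.
have [b0 [size_b free_b bA]] := free_system (fun i i_in => (lamP i i_in).2).
pose b := Tuple (introT eqP size_b).
have b_int (i : 'I_n) k : b`_i 0 k \is a Num.int.
  by have [_ /mxOverP] := bA i (ltn_ord i); apply.
have /choice[y yP] (i : 'I_n) : exists y, C y /\ b`_i = lam i.+1 *: y.
  by have [[y Cy <-] _] := bA i (ltn_ord i); exists y.
have lam_ge0 (i : 'I_n) : 0 <= lam i.+1 by apply/ltW; case: (lamP i.+1 (ltn_ord i)).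
have prod_lt' : (\prod_(i < n) (p.-1 %/ (s i.+1).+1).+1 < p)%N.
  by move: prod_lt; rewrite big_add1 /= big_mkord.
have := fun t : 'F_p => @small_multiple p n (fun i => s i.+1) (fun i => t ^+ i) pp prod_lt'.
move=> /choice[a /choice[c cP]].
have a_neq0 t := (cP t).1; have cE t i := ((cP t).2 i).1.
have c_le t i := ((cP t).2 i).2.
pose x t := \sum_(i < n) (c t i)%:~R *: b`_i.
have x_row (k : 'F_p ^ n) : injective k ->
    (\matrix_(j < n) x (k j)) \in unitmx.
  move=> inj_k; have -> : \matrix_(j < n) x (k j) =
      (\matrix_(j, i) (c (k j) i)%:~R) *m (\matrix_(i < n) b`_i).
    apply/row_matrixP => j; rewrite rowK row_mul mulmx_sum_row.
    by apply: eq_bigr => i _; rewrite rowK !mxE.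
  rewrite unitmx_mul -(free_rows_unitmx b) free_b andbT.
  exact: (unitmx_moment _ pp inj_k (fun j => a_neq0 (k j)) (fun j i => cE (k j) i)).
(* Independence of [b] recovers c_t from x_t. Modulo p, coordinate 0 of c_t is a_t and coordinate 1
   is a_t t; the latter exists because n >= 2. *)
have x_inj : injective x.
  move=> t u /eqP; rewrite -subr_eq0 -sumrB => /eqP xtu.
  have ctu i : c t i = c u i.
    have := freeP (X := b) free_b (fun i => (c t i)%:~R - (c u i)%:~R).
    move=> /(_ _ i) e; apply/eqP; rewrite -(eqr_int R) -subr_eq0; apply/eqP/e.
    by rewrite -[RHS]xtu; apply: eq_bigr => j _; rewrite scalerBl.
  have atu : a t = a u.
    have := cE t (Ordinal (ltnW n_ge2)); rewrite ctu cE /= !expr0 !mulr1.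
    by move=> ->.
  have := cE t (Ordinal n_ge2); rewrite ctu cE atu /= !expr1.
  by move/(mulfI (a_neq0 u)).
exists [seq x t | t <- enum 'F_p]; split.
- by rewrite map_inj_uniq ?enum_uniq.
- by rewrite size_map -cardE card_Fp.
- move=> _ /mapP[t _ ->]; split.
    have -> : x t = \sum_(i < n) ((c t i)%:~R * lam i.+1) *: y i.
      by apply: eq_bigr => i _; rewrite (yP i).2 scalerA.
    apply: symmetric_convex_sum => // [i|]; first by case: (yP i).
    apply: le_trans sum_le; rewrite big_add1 /= big_mkord.
    apply: ler_sum => i _; rewrite normrM (ger0_norm (lam_ge0 i)).
    rewrite ler_wpM2r ?lam_ge0 // -intr_norm -abszE -pmulrn ler_nat.
    exact: c_le.
  apply/mxOverP => i j; rewrite summxE; apply: rpred_sum => k _.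
  by rewrite mxE rpredM ?intr_int // (ord1 i).
- move=> r uniq_r sub_r.
  have /choice[k kP] (j : 'I_n) : exists t, tnth r j = x t.
    by have /sub_r/mapP[t _ ->] := mem_tnth j r; exists t.
  rewrite free_rows_unitmx.
  have -> : \matrix_(i < n) r`_i = \matrix_(j < n) x ([ffun j => k j] j).
    by apply/row_matrixP => j; rewrite !rowK ffunE -kP (tnth_nth 0).
  apply: x_row => i j; rewrite !ffunE => kij; apply/val_inj/eqP.
  rewrite /= -(nth_uniq 0 _ _ uniq_r) ?size_tuple //.
  by rewrite -!tnth_nth !kP kij.
Qed.
End SymmetricConvex.

(** * Attained extrema and the lower bound *)

Lemma set_max_nat_ge (A : set nat) (N k : nat) :
  (forall j, A j -> (j <= N)%N) -> A k -> (k <= set_max 0%N A)%N.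
Proof.
move=> A_le Ak; rewrite /set_max; case: xgetP => [m _ [_ m_ub]|noM].
  by have := m_ub k Ak; rewrite leEnat.
have exA : exists j, `[< A j >] by exists k; apply/asboolP.
have ubA j : `[< A j >] -> (j <= N)%N by move/asboolP/A_le.
case: (ex_maxnP exA ubA) => m /asboolP Am m_max.
by case: (noM m); split=> // j Aj; rewrite leEnat; apply/m_max/asboolP.
Qed.

(** The coordinates are integers of absolute value at most K = floor M; shifted by K, they embed the
    lattice points of C into a finite type. Hence the maximum defining h(C) is attained. *)
Lemma lattice_points_bounded (R : realType) (n : nat) (C : set 'rV[R]_n) :
  compact C -> exists N, forall r : seq 'rV[R]_n,
    uniq r -> (forall x, x \in r -> (C `&` int_lattice) x) -> (size r <= N)%N.
Proof.
move=> /compact_bounded/ex_strict_bound_gt0[M M_gt0 C_lt].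
pose K := Num.truncn M.
have coord_le x j : (C `&` int_lattice) x -> exists2 z : int, x 0 j = z%:~R & (`|z| <= K)%N.
  move=> [/C_lt lt_M /mxOverP/(_ 0 j)/intrP[z xz]]; exists z => //.
  rewrite truncn_ge_nat ?(ltW M_gt0) // natr_absz intr_norm -xz.
  apply: le_trans (ltW lt_M); rewrite [leRHS]mx_normrE.
  exact: (le_bigmax _ (fun ij : 'I_1 * 'I_n => `|x ij.1 ij.2|) (0, j)).
pose g (x : 'rV[R]_n) : {ffun 'I_n -> 'I_(K + K).+1} :=
  [ffun j => inord (absz (Num.floor (x 0 j) + K%:Z))].
exists #|{ffun 'I_n -> 'I_(K + K).+1}| => r uniq_r r_sub.
have uniq_gr : uniq (map g r).
  rewrite map_inj_in_uniq // => x y /r_sub Lx /r_sub Ly /ffunP eq_g.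
  apply/rowP => j; have := eq_g j; rewrite !ffunE => /(congr1 val) /=.
  have [z -> z_le] := coord_le x j Lx; have [z' -> z'_le] := coord_le y j Ly.
  by rewrite !intrKfloor !inordK; [move=> ?; congr _%:~R; lia|lia..].
by rewrite -(size_map g) -(card_uniqP uniq_gr) max_card.
Qed.

(** The default 0 is not an admissible factor, so a nonzero value is an attained minimum. *)
Lemma successive_minimumP (R : realType) (n : nat) (C : set 'rV[R]_n) (i : nat) :
  successive_minimum C i != 0 ->
  [/\ 0 < successive_minimum C i,
    (i <= \dim (span_set ([set successive_minimum C i *: x | x in C] `&` int_lattice)))%N &
    forall l, 0 < l ->
      (i <= \dim (span_set ([set l *: x | x in C] `&` int_lattice)))%N ->
      successive_minimum C i <= l].
Proof.
rewrite /successive_minimum /set_min; case: xgetP => [l _ [[l_gt0 l_dim] l_lb] _|].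
  by split=> // l' l'_gt0 l'_dim; apply: l_lb.
by rewrite eqxx.
Qed.

(** Let t = floor B, positive since B > 1. A prime with t < p < 4t satisfies both B < t + 1 <= p and
    p < 4B, as the box sizes require. *)
Lemma general_position_of_large_bound (R : realType) (n : nat) (C : set 'rV[R]_n) :
  let lam := successive_minimum C in
  let P := set_min 0 [set (\prod_(m <= i < n.+1) lam i) `^ (- (n - m)%:R^-1)
                     | m in [set m : nat | (0 < m < n)%N]] in
  (2 <= n)%N -> convex_body C -> origin_symmetric C -> lam n <= 1 ->
  0 < P -> 1 < (1 - lam n) / (16 * n%:R ^+ 2) * P ->
  exists p : nat, (1 - lam n) / (16 * n%:R ^+ 2) * P <= p%:R /\
    exists r : seq 'rV[R]_n, [/\ uniq r, size r = p,
      (forall x, x \in r -> (C `&` int_lattice) x) & no_n_dependent r].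
Proof.
move=> lam P n_ge2 [_ convC [x0 /interior_subset Cx0]] symC lam_n P_gt0 B_gt1.
have P_lb m : (0 < m < n)%N -> P <= (\prod_(m <= i < n.+1) lam i) `^ (- (n - m)%:R^-1).
  move: P_gt0; rewrite /P /set_min; case: xgetP => [P' _ [_ P'_lb] _ m_in|].
    by apply: P'_lb; exists m.
  by rewrite ltxx.
(* An unattained minimum has the default value 0, and 0 `^ x = 0 for x != 0
   would then make P vanish. *)
have lam_neq0 i : (0 < i <= n)%N -> lam i != 0.
  move=> i_in; apply/eqP => lam0; have := P_lb 1%N n_ge2; rewrite leNgt.
  rewrite (_ : \prod_(1 <= i < n.+1) _ = 0) ?powR0 ?P_gt0 //.
    by rewrite oppr_eq0 invr_eq0 pnatr_eq0; lia.
  by rewrite (bigD1_seq i) ?mem_index_iota ?iota_uniq //= lam0 mul0r.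
have lamP i (i_in : (0 < i <= n)%N) := successive_minimumP (lam_neq0 i i_in).
have lam_gt0 i : (0 < i <= n)%N -> 0 < lam i by case/lamP.
(* A factor admissible for j is admissible for every i <= j. *)
have lam_homo i j : (0 < i)%N -> (i <= j <= n)%N -> lam i <= lam j.
  move=> i0 /andP[le_ij le_jn].
  have i_in : (0 < i <= n)%N by rewrite i0 (leq_trans le_ij).
  have j_in : (0 < j <= n)%N by rewrite (leq_trans i0).
  have [_ _] := lamP i i_in; apply; first exact: lam_gt0.
  by have [_ + _] := lamP j j_in; apply: leq_trans.
have P_le m : (0 < m < n)%N -> P ^+ (n - m) * \prod_(m <= i < n.+1) lam i <= 1.
  move=> m_in; set Q := \prod_(_ <= _ < _) _.
  have Q_gt0 : 0 < Q.
    rewrite /Q big_nat; apply: prodr_gt0 => i i_in; apply: lam_gt0; lia.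
  have k_neq0 : (n - m)%:R != 0 :> R by rewrite pnatr_eq0; lia.
  rewrite -ler_pdivlMr // mul1r.
  apply: le_trans (_ : (Q `^ (- (n - m)%:R^-1)) ^+ (n - m) <= _).
    by apply: lerXn2r; rewrite ?nnegrE ?powR_ge0 ?(ltW P_gt0) ?P_lb.
  rewrite -powR_mulrn ?powR_ge0 // -powRrM mulNr mulVf // powR_inv1 //.
  exact: ltW.
set B := _ * P in B_gt1 *.
have n_gt0 : 0 < n%:R :> R by rewrite ltr0n; lia.
have B_itv : (Num.truncn B)%:R <= B < (Num.truncn B).+1%:R.
  by apply: truncn_itv; apply: ltW; apply: lt_trans B_gt1.
move/andP: B_itv; set t := Num.truncn B => -[t_le lt_t].
have t_gt0 : (0 < t)%N.
  by rewrite -ltnS -(ltr_nat R); apply: lt_trans lt_t.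
have [p [pp lt_tp lt_p4t]] := prime_between t_gt0.
have p_lt : p%:R * (4 * n%:R ^+ 2) < (1 - lam n) * P.
  have -> : (1 - lam n) * P = 4 * B * (4 * n%:R ^+ 2).
    by rewrite /B; field; rewrite gt_eqF.
  rewrite ltr_pM2r ?mulr_gt0 ?exprn_gt0 //.
  apply: lt_le_trans (_ : 4 * t%:R <= _); last by rewrite ler_pM2l.
  by rewrite -natrM ltr_nat.
have [s [sum_s prod_s]] := box_sizes n_ge2 (prime_gt1 pp) lam_gt0 lam_homo lam_n P_gt0 P_le p_lt.
exists p; split.
  by apply: le_trans (ltW lt_t) _; rewrite ler_nat.
apply: (general_position_points convC symC (symmetric_convex0 convC symC Cx0) n_ge2 pp _ sum_s prod_s).
by move=> i /lamP[].
Qed.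

Theorem theorem1 (R : realType) (n : nat) (C : set 'rV[R]_n) :
  (2 <= n)%N ->
  convex_body C ->
  origin_symmetric C ->
  successive_minimum C n <= 1 ->
  (1 - successive_minimum C n) / (16 * n%:R ^+ 2)
    * set_min 0 [set (\prod_(m <= i < n.+1) successive_minimum C i)
                       `^ (- (n - m)%:R^-1)
                | m in [set m : nat | (0 < m < n)%N]]
  <= (max_general_position C)%:R.
Proof.
move=> n_ge2 bodyC symC lam_n; set B := _ * _.
have [cC convC [x0 /interior_subset Cx0]] := bodyC.
have [N C_le] := lattice_points_bounded cC.
have h_ge k : (exists r : seq 'rV[R]_n, [/\ uniq r, size r = k,
    (forall x, x \in r -> (C `&` int_lattice) x) & no_n_dependent r]) ->
    (k <= max_general_position C)%N.
  by apply: (@set_max_nat_ge _ N) => _ [r [uniq_r <- r_sub _]]; apply: C_le.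
(* If B <= 1, the single point 0 suffices: as n >= 2, it contains no n distinct points. *)
have [B_le1|B_gt1] := leP B 1.
  apply: le_trans B_le1 _; rewrite ler1n; apply: h_ge.
  exists [:: 0]; split=> // [x|t uniq_t sub_t].
    rewrite inE => /eqP ->; split; first exact: (symmetric_convex0 convC symC Cx0).
    by apply/mxOverP => i j; rewrite mxE rpred0.
  have := uniq_leq_size uniq_t sub_t; rewrite size_tuple => /(leq_trans n_ge2).
  by [].
have [|p [B_le /h_ge p_le]] := general_position_of_large_bound n_ge2 bodyC symC lam_n _ B_gt1.
  (* A nonpositive minimum, in particular the default 0, would give B <= 0. *)
  rewrite ltNge; apply/negP => P_le0; move: B_gt1; rewrite ltNge => /negP; apply.
  apply: le_trans ler01; apply: mulr_ge0_le0 => //.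
  by rewrite divr_ge0 ?subr_ge0 // mulr_ge0 ?sqr_ge0.
by apply: le_trans B_le _; rewrite ler_nat.
Qed.
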